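(* Let $\beta$ be a Parry number with Parry polynomial $n_\beta^*(X)$ and minimal polynomial $P_\beta(X)$. Then every irreducible factor of $n_\beta^*(X)$ in $\mathbb{Z}[X]$, other than $P_\beta(X)$, which is not cyclotomic has at least one root of modulus $>1$.
   Context: For non-integer $\beta>1$, $d_\beta(1)=0.t_1t_2\ldots$ with $t_1=\lfloor\beta\rfloor$, $t_{j+1}=\lfloor\beta T_\beta^j(1)\rfloor$, $T_\beta(x)=\beta x-\lfloor\beta x\rfloor$; $\beta$ is a Parry number if $(t_i)$ is eventually periodic. Parry polynomial: if $t_i=0$ for $i>m$, $t_m\neq0$: $n_\beta^*(X)=X^m-\sum_{i=1}^mt_iX^{m-i}$; otherwise with minimal preperiod $m\ge0$ and period $p+1$: if $m\ge1$, $n_\beta^*(X)=X^{m+p+1}-\sum_{i=1}^{m+p+1}t_iX^{m+p+1-i}-X^m+\sum_{i=1}^mt_iX^{m-i}$; if $m=0$, $n_\beta^*(X)=X^{p+1}-\sum_{i=1}^pt_iX^{p+1-i}-(1+t_{p+1})$. It is monic in $\mathbb{Z}[X]$ and divisible by $P_\beta$. *)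

(* Defs.v *)
From HB Require Import structures.
From mathcomp Require Import all_boot all_order all_algebra all_field.
From mathcomp Require Import complex.
From mathcomp Require Import reals.
Set Implicit Arguments.
Unset Strict Implicit.
Unset Printing Implicit Defensive.
Import Order.TTheory GRing.Theory Num.Theory.
Local Open Scope ring_scope.

Definition beta_transform (R : realType) (beta x : R) : R :=
  beta * x - (Num.floor (beta * x))%:~R.

(* The Renyi digits t_1, t_2, ... of d_beta(1).  Digits are indexed from 1;
   the value at index 0 is junk and is never consulted below. *)
Definition renyi_digit (R : realType) (beta : R) (i : nat) : int :=
  Num.floor (beta * iter i.-1 (beta_transform beta) 1).

(* t_(i + p + 1) = t_i for all i > m: preperiod m and period p + 1, neither
   required to be minimal. *)
Definition eventually_periodic (t : nat -> int) (m p : nat) : Prop :=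
  forall i : nat, (m < i)%N -> t (i + p.+1)%N = t i.

Definition minimally_periodic (t : nat -> int) (m p : nat) : Prop :=
  eventually_periodic t m p /\
  forall m' p' : nat, eventually_periodic t m' p' -> (m <= m')%N /\ (p <= p')%N.

Definition finite_expansion (t : nat -> int) (m : nat) : Prop :=
  [/\ (0 < m)%N, t m <> 0 & forall i : nat, (m < i)%N -> t i = 0].

Definition parry_number (R : realType) (beta : R) : Prop :=
  [/\ 1 < beta, (forall k : int, beta <> k%:~R)
    & exists m p : nat, eventually_periodic (renyi_digit beta) m p].

(* parry_polynomial_of t n: n is the Parry polynomial attached to the digit
   sequence t. *)
Variant parry_polynomial_of (t : nat -> int) : {poly int} -> Prop :=
| ParryFinite (m : nat) of finite_expansion t m :
    parry_polynomial_of t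
      ('X^m - \sum_(1 <= i < m.+1) (t i)%:P * 'X^(m - i))
| ParryPreperiodic (m p : nat) of
      (forall k : nat, ~ finite_expansion t k) & minimally_periodic t m p
      & (0 < m)%N :
    parry_polynomial_of t
      ('X^(m + p + 1)
       - \sum_(1 <= i < (m + p + 1).+1) (t i)%:P * 'X^(m + p + 1 - i)
       - 'X^m + \sum_(1 <= i < m.+1) (t i)%:P * 'X^(m - i))
| ParryPurelyPeriodic (p : nat) of
      (forall k : nat, ~ finite_expansion t k) & minimally_periodic t 0 p :
    parry_polynomial_of t
      ('X^(p + 1) - \sum_(1 <= i < p.+1) (t i)%:P * 'X^(p + 1 - i)
       - (1 + t (p + 1)%N)%:P).

Definition parry_polynomial (R : realType) (beta : R) (n : {poly int}) : Prop :=
  parry_polynomial_of (renyi_digit beta) n.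

(* The minimal polynomial over the rationals of an algebraic integer, which has
   integer coefficients. *)
Definition minimal_polynomial (R : realType) (beta : R) (P : {poly int}) : Prop :=
  [/\ P \is monic, root (map_poly intr P) beta
    & forall f : {poly rat}, f != 0 -> root (map_poly ratr f) beta ->
        (size P <= size f)%N].

(* Irreducibility as an element of the ring Z[X]; the library's
   irreducible_poly rests on pseudo-division, hence over int on divisibility up
   to integer scalars. *)
Definition irreducible_Zpoly (q : {poly int}) : Prop :=
  [/\ q != 0, q \isn't a GRing.unit
    & forall a b : {poly int}, q = a * b ->
        a \is a GRing.unit \/ b \is a GRing.unit].

Definition divides_Zpoly (q n : {poly int}) : Prop :=
  exists r : {poly int}, n = q * r.

(* The units of Z[X] are 1 and -1. *)
Definition associated_Zpoly (p q : {poly int}) : Prop := p = q \/ p = - q.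

Definition cyclotomic_Zpoly (q : {poly int}) : Prop :=
  exists2 k : nat, (0 < k)%N & associated_Zpoly q 'Phi_k.

(* Main.v *)
Require Import Defs.
From HB Require Import structures.
From mathcomp Require Import all_boot all_order all_algebra all_field.
From mathcomp Require Import complex.
From mathcomp Require Import reals.
Set Implicit Arguments.
Unset Strict Implicit.
Unset Printing Implicit Defensive.
Import Order.TTheory GRing.Theory Num.Theory.
Local Open Scope ring_scope.

(** The Parry polynomial n is monic and n(0) is nonzero: n(0) is - t_m,
    t_m - t_(m+p+1) (nonzero by minimality of the preperiod) or
    - (1 + t_(p+1)).  Hence an irreducible factor q of n has leading coefficient
    1 or -1 and nonzero roots.  If no root of q lay outside the unit disk,
    Kronecker's theorem would make some root of q a root of unity, and q would
    be cyclotomic. *)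

(** * Graeffe's root-squaring transform *)

Definition graeffe (R : nzRingType) (p : {poly R}) : {poly R} :=
  even_poly p ^+ 2 - odd_poly p ^+ 2 * 'X.

(** Write p = e(X^2) + X o(X^2) with even part e and odd part o. Substituting -X changes the sign of
    the second term, so the right-hand side is a difference of two squares. *)
Lemma graeffe_comp_sqr (R : comNzRingType) (p : {poly R}) :
  graeffe p \Po 'X^2 = p * (p \Po - 'X).
Proof.
have sqrNX : 'X^2 \Po - 'X = 'X^2 :> {poly R} by rewrite comp_Xn_poly sqrrN.
rewrite /graeffe comp_polyB !(comp_polyM, expr2) comp_polyX -!expr2.
rewrite -[_ * 'X^2]exprMn subr_sqr mulrC.
rewrite -{5 6}(poly_even_odd p) comp_polyD comp_polyM comp_polyX -!comp_polyA.
by rewrite sqrNX mulrN.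
Qed.

Lemma size_graeffe (R : idomainType) (p : {poly R}) :
  size (graeffe p) = size p.
Proof.
have [->|p_neq0] := eqVneq p 0.
  by rewrite /graeffe -polyC0 even_polyC odd_polyC polyC0 expr0n mul0r subr0.
have szNX : size (- 'X : {poly R}) = 2 by rewrite size_polyN size_polyX.
have pN_neq0 : p \Po - 'X != 0 by rewrite comp_poly2_eq0.
have gp_neq0 : graeffe p != 0.
  by rewrite -(@comp_poly_eq0 _ _ 'X^2) ?size_polyXn //
    graeffe_comp_sqr mulf_neq0.
(* Both sides of [graeffe_comp_sqr] have twice the degree of their polynomial. Nonvanishing lets the
   sizes be recovered from the degrees. *)
have := size_comp_poly (graeffe p) 'X^2.
rewrite graeffe_comp_sqr size_mul // size_comp_poly2 // size_polyXn /= muln2.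
have := p_neq0; have := gp_neq0; rewrite -!size_poly_gt0.
case: (size p) (size (graeffe p)) => // m [//|k] _ _ /=.
by rewrite addnS /= addnn => /double_inj ->.
Qed.

Lemma lead_coef_graeffe_unit (R : idomainType) (p : {poly R}) :
  lead_coef p \is a GRing.unit -> lead_coef (graeffe p) \is a GRing.unit.
Proof.
move=> p_unit; have := lead_coef_comp (graeffe p) (q := 'X^2).
rewrite size_polyXn lead_coefXn expr1n mulr1 => /(_ isT) <-.
rewrite graeffe_comp_sqr lead_coefM lead_coef_comp ?size_polyN ?size_polyX //.
by rewrite lead_coefN lead_coefX !unitrM p_unit unitrX ?unitrN1.
Qed.

Lemma horner_graeffe_sqr (R : comNzRingType) (p : {poly R}) z :
  (graeffe p).[z ^+ 2] = p.[z] * p.[- z].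
Proof.
have := congr1 (horner^~ z) (graeffe_comp_sqr p).
by rewrite hornerM !horner_comp hornerXn hornerN hornerX.
Qed.

Lemma map_graeffe (R S : nzRingType) (f : {rmorphism R -> S}) (p : {poly R}) :
  map_poly f (graeffe p) = graeffe (map_poly f p).
Proof.
have map_even : map_poly f (even_poly p) = even_poly (map_poly f p).
  by apply/polyP => i; rewrite !(coef_map, coef_even_poly).
have map_odd : map_poly f (odd_poly p) = odd_poly (map_poly f p).
  by apply/polyP => i; rewrite !(coef_map, coef_odd_poly).
by rewrite /graeffe !expr2 rmorphB !rmorphM /= map_polyX map_even map_odd.
Qed.

Lemma root_graeffe (C : numClosedFieldType) (p : {poly C}) z :
  root (graeffe p) z = root p (sqrtC z) || root p (- sqrtC z).
Proof. by rewrite /root -{1}[z]sqrtCK horner_graeffe_sqr mulf_eq0. Qed.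

(** * Integer polynomials with all roots in the closed unit disk *)

Lemma norm_coef_prod_XsubC (C : numDomainType) (r : seq C) i :
  {in r, forall z, `|z| <= 1} ->
  `|(\prod_(z <- r) ('X - z%:P))`_i| <= 2 ^+ size r.
Proof.
elim: r i => [|z r IHr] i r_le1.
  by rewrite big_nil coef1 normr_nat lern1 leq_b1.
have {}IHr j : `|(\prod_(w <- r) ('X - w%:P))`_j| <= 2 ^+ size r.
  by apply: IHr => w wr; rewrite r_le1 // in_cons wr orbT.
(* A factor X - z subtracts z times a coefficient from its neighbour; as z has modulus at most 1,
   the bound at most doubles. *)
rewrite big_cons mulrBl coefB coefXM coefCM exprS mulr_natl mulr2n.
apply: le_trans (ler_normB _ _) _; apply: lerD.
  by case: ifP => // _; rewrite normr0 exprn_ge0.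
by rewrite normrM -[leRHS]mul1r ler_pM // r_le1 ?mem_head.
Qed.

Lemma int_unit_norm (a : int) : (a \is a GRing.unit) = (`|a| == 1).
Proof. by case: a => [[|[|n]]|[|n]]. Qed.

Lemma norm_coef_roots_le1 (C : numClosedFieldType) (p : {poly int}) i :
  lead_coef p \is a GRing.unit ->
  (forall z : C, root (map_poly intr p) z -> `|z| <= 1) ->
  `|p`_i| <= 2 ^+ (size p).-1.
Proof.
rewrite int_unit_norm => /eqP p_lead p_roots.
have lead_neq0 : lead_coef p != 0 by rewrite -normr_gt0 p_lead.
pose pC := map_poly intr p : {poly C}.
have pC_lead : lead_coef pC = (lead_coef p)%:~R.
  by rewrite lead_coef_map_eq ?intr_eq0.
have [r pC_def] := closed_field_poly_normal pC.
have pC_lead_neq0 : lead_coef pC != 0 by rewrite pC_lead intr_eq0.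
have sz_r : size r = (size p).-1.
  have <- : size pC = size p by rewrite size_map_poly_id0 // intr_eq0.
  by rewrite pC_def size_scale // size_prod_XsubC.
rewrite -(ler_int C) intr_norm -coef_map -/pC pC_def coefZ normrM pC_lead.
rewrite -intr_norm p_lead mul1r rmorphXn /= -sz_r.
apply: norm_coef_prod_XsubC => z zr; apply: p_roots.
by rewrite -/pC pC_def rootZ // root_prod_XsubC.
Qed.

(** Only finitely many integer polynomials have size at most d and coefficients in [-B, B]; m is the
    product of the nonzero ones. *)
Lemma bounded_int_poly_common_multiple (C : numClosedFieldType) (d B : nat) :
  exists2 m : {poly C}, m != 0
    & forall (p : {poly int}) z, p != 0 -> (size p <= d)%N ->
        (forall i, `|p`_i| <= B%:Z) -> root (map_poly intr p) z -> root m z.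
Proof.
(* Coefficients are stored shifted by B, as codes from 0 to 2B, so that the family is a finite
   type. *)
pose pf (f : {ffun 'I_d -> 'I_(B.*2.+1)}) : {poly int} :=
  \sum_(i < d) ((f i)%:Z - B%:Z) *: 'X^i.
pose toC (p : {poly int}) : {poly C} := map_poly intr p.
have toC_neq0 p : p != 0 -> toC p != 0.
  by move=> p_neq0; rewrite map_poly_eq0_id0 // intr_eq0 lead_coef_eq0.
exists (\prod_(f | pf f != 0) toC (pf f)).
  by apply/prodf_neq0 => f; apply: toC_neq0.
move=> p z p_neq0 sz_p p_le rpz.
pose f : {ffun 'I_d -> 'I_(B.*2.+1)} :=
  [ffun i => inord `|(p`_(val i) + B%:Z)%R|%N].
have p_def : pf f = p.
  rewrite /pf; transitivity (\poly_(i < d) p`_i); last first.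
    apply/polyP => i; rewrite coef_poly.
    case: ltnP => // /(leq_trans sz_p) le_i.
    by rewrite nth_default.
  rewrite poly_def; apply: eq_bigr => i _; congr (_ *: _).
  have := p_le i; rewrite ler_norml => /andP [lo hi].
  have ge0 : 0 <= p`_i + B%:Z by rewrite -lerBlDr sub0r.
  rewrite ffunE inordK ?gez0_abs ?addrK //.
  by rewrite ltnS -lez_nat gez0_abs // -addnn PoszD lerD2r.
rewrite (bigD1 f) ?p_def //= rootM; apply/orP; left; exact: rpz.
Qed.

(* Graeffe's transform squares the roots and keeps the degree and the bound on
   the roots, so the powers z^(2^j) are roots of integer polynomials of bounded
   degree and height, and two of them coincide. *)
Lemma kronecker (C : numClosedFieldType) (p : {poly int}) (z : C) :
  lead_coef p \is a GRing.unit ->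
  (forall w : C, root (map_poly intr p) w -> `|w| <= 1) ->
  root (map_poly intr p) z -> z != 0 ->
  exists2 k, (0 < k)%N & z ^+ k = 1.
Proof.
move=> p_lead p_roots rpz z_neq0; pose g j := iter j (@graeffe int) p.
have g_lead j : lead_coef (g j) \is a GRing.unit.
  by elim: j => //= j; apply: lead_coef_graeffe_unit.
have g_size j : size (g j) = size p.
  by elim: j => //= j IHj; rewrite size_graeffe.
have g_roots j (w : C) : root (map_poly intr (g j)) w -> `|w| <= 1.
  elim: j w => [|j IHj] w /=; first exact: p_roots.
  (* One of the two square roots of w is a root of the previous iterate. *)
  rewrite map_graeffe root_graeffe -[in X in _ -> X](sqrtCK w) normrX.
  by case/orP => /IHj; rewrite ?normrN => w_le1; rewrite expr_le1.
have g_pow j : root (map_poly intr (g j)) (z ^+ (2 ^ j)).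
  elim: j => [|j IHj] //=.
  by rewrite map_graeffe /root expnSr exprM horner_graeffe_sqr (eqP IHj) mul0r.
have [m m_neq0 m_roots] :=
  bounded_int_poly_common_multiple C (size p) (2 ^ (size p).-1).
have m_pow j : root m (z ^+ (2 ^ j)).
  apply: m_roots (g_pow j); rewrite ?g_size //.
    by rewrite -lead_coef_eq0; apply: contraTneq (g_lead j) => ->.
  move=> i; rewrite -(g_size j) -natz natrX.
  exact: norm_coef_roots_le1 (g_roots j).
(* A nonzero m has fewer than [size m] distinct roots, so among this many powers two agree. *)
pose s := [seq z ^+ (2 ^ j) | j <- iota 0 (size m)].
have s_uniq : ~~ uniq s.
  have s_roots : all (root m) s by apply/allP => _ /mapP [j _ ->].
  apply/negP => /(max_poly_roots m_neq0 s_roots).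
  by rewrite size_map size_iota ltnn.
have [i [j [lt_ij eq_ij]]] :
    exists i j, (i < j)%N /\ z ^+ (2 ^ i) = z ^+ (2 ^ j).
  have /(uniqPn 0) [i [j [lt_ij]]] := s_uniq.
  rewrite size_map size_iota => lt_j eq_ij; exists i, j; split => //.
  have lt_i := ltn_trans lt_ij lt_j.
  by move: eq_ij; rewrite !(nth_map 0%N) ?size_iota // !nth_iota.
(* Cancel z^(2^i) in z^(2^i) = z^(2^j). *)
exists (2 ^ j - 2 ^ i)%N; first by rewrite subn_gt0 ltn_exp2l.
apply: (mulfI (expf_neq0 (2 ^ i) z_neq0)).
by rewrite mulr1 -exprD subnKC // leq_exp2l // ltnW.
Qed.

(** * Irreducible polynomials vanishing at a root of unity *)

Lemma irreducible_root_unity_cyclotomic (C : numClosedFieldType)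
    (q : {poly int}) (z : C) (k : nat) :
  irreducible_Zpoly q -> root (map_poly intr q) z ->
  (0 < k)%N -> z ^+ k = 1 -> cyclotomic_Zpoly q.
Proof.
move=> [q_neq0 q_nunit q_irr] qz k_gt0 zk1.
pose qQ := map_poly intr q : {poly rat}; pose u := 'X^k - 1 : {poly rat}.
have ratr_intr (F : numFieldType) :
    map_poly ratr qQ = map_poly intr q :> {poly F}.
  by rewrite -map_poly_comp; apply: eq_map_poly => c /=; rewrite ratr_int.
have ratr_u (F : numFieldType) : map_poly ratr u = 'X^k - 1 :> {poly F}.
  by rewrite rmorphB /= map_polyXn rmorph1.
(* Coprimality over the rationals would persist over [C], where z is a common root. *)
have : size (gcdp qQ u) != 1.
  apply/negP => qu_coprime.
  have : coprimep (map_poly (ratr : rat -> C) qQ) (map_poly ratr u).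
    by rewrite coprimep_map.
  move/coprimep_root => /(_ z); rewrite ratr_intr ratr_u => /(_ qz).
  by rewrite !hornerE zk1 subrr eqxx.
(* The rational gcd carries the common root from [C] to [algC], where the minimal polynomial of a
   primitive n-th root of unity is known to be ['Phi_n]. *)
rewrite -(size_map_poly (ratr : {rmorphism rat -> algC})) => /closed_rootP [w].
rewrite gcdp_map root_gcd ratr_intr ratr_u => /andP [qw].
rewrite /root !hornerE subr_eq0 => /eqP wk1.
have [n prim_w _] := prim_order_exists k_gt0 wk1.
have n_gt0 := prim_order_gt0 prim_w.
have Phi_q : 'Phi_n %| q.
  have [p [minC_p _] p_dvd] := minCpolyP w.
  move: qw; rewrite -ratr_intr p_dvd -dvdp_rat_int; congr (_ %| _).
  apply: (map_poly_inj (ratr : {rmorphism rat -> algC})).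
  rewrite -minC_p (minCpoly_cyclotomic prim_w) -(Cintr_Cyclotomic prim_w).
  by rewrite -map_poly_comp; apply: eq_map_poly => c /=; rewrite ratr_int.
(* Since ['Phi_n] is monic, pseudo-divisibility is true divisibility in Z[X]. *)
have [r q_def] : exists r, q = r * 'Phi_n.
  by apply/(Pdiv.IdomainMonic.dvdpP (Cyclotomic_monic n)).
have [r_unit | Phi_unit] := q_irr _ _ q_def; last first.
  move: Phi_unit; rewrite poly_unitE size_Cyclotomic eqSS.
  by rewrite -leqn0 leqNgt totient_gt0 n_gt0.
exists n => //; rewrite /associated_Zpoly q_def.
move: r_unit; rewrite poly_unitE => /andP [/eqP/eq_leq/size1_polyC ->].
rewrite coefC eqxx => /orP [] /eqP ->; [left|right].
  by rewrite mul1r.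
by rewrite polyCN mulN1r.
Qed.

(** * Leading and constant coefficients of the Parry polynomial *)

Lemma size_digit_sum (t : nat -> int) (b m : nat) :
  (0 < m)%N -> (size (\sum_(1 <= i < b) (t i)%:P * 'X^(m - i))%R <= m)%N.
Proof.
move=> m_gt0; rewrite big_nat.
elim/big_ind: _ => [|p q p_le q_le|i /andP [i_gt0 _]].
- by rewrite size_poly0.
- by rewrite (leq_trans (size_polyD _ _)) // geq_max p_le.
- rewrite mul_polyC (leq_trans (size_scale_leq _ _)) // size_polyXn.
  (* Subtraction is truncated, so m - i < m also holds for i > m. *)
  by rewrite ltn_subrL i_gt0.
Qed.

Lemma coef0_digit_sum_lt (t : nat -> int) (b m : nat) :
  (b <= m)%N -> (\sum_(1 <= i < b) (t i)%:P * 'X^(m - i))`_0 = 0.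
Proof.
move=> le_bm; rewrite coef_sum big_nat big1 // => i /andP [_ lt_ib].
by rewrite coefCM coefXn eq_sym subn_eq0 leqNgt (leq_trans lt_ib) // mulr0.
Qed.

Lemma coef0_digit_sum (t : nat -> int) (m : nat) :
  (0 < m)%N -> (\sum_(1 <= i < m.+1) (t i)%:P * 'X^(m - i))`_0 = t m.
Proof.
move=> m_gt0; rewrite big_nat_recr //= coefD coef0_digit_sum_lt // add0r.
by rewrite subnn mulr1 coefC.
Qed.

Lemma monic_XnD (R : nzRingType) (m : nat) (p : {poly R}) :
  (size p <= m)%N -> 'X^m + p \is monic.
Proof.
by move=> p_le; rewrite monicE lead_coefDl ?size_polyXn ?ltnS // lead_coefXn.
Qed.

(** The orbit of 1 starts at 1 and continues with fractional parts. This makes 1 + t_(p+1) positive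
    in the purely periodic case. *)
Lemma renyi_digit_ge0 (R : realType) (beta : R) :
  1 < beta -> forall i, 0 <= renyi_digit beta i.
Proof.
move=> beta_gt1 i; have beta_ge0 : 0 <= beta by rewrite ltW // (lt_trans ltr01).
rewrite /renyi_digit floor_ge0 mulr_ge0 //.
by case: i.-1 => [|k] //=; rewrite /beta_transform subr_ge0 floor_le.
Qed.

Lemma parry_polynomial_of_monic (t : nat -> int) (n : {poly int}) :
  parry_polynomial_of t n -> n \is monic.
Proof.
have sizeD (p q : {poly int}) k :
    (size p <= k)%N -> (size q <= k)%N -> (size (p + q)%R <= k)%N.
  by move=> p_le q_le; rewrite (leq_trans (size_polyD _ _)) // geq_max p_le.
case=> [m [m_gt0 _ _] | m p _ _ m_gt0 | p _ _].
- by rewrite monic_XnD // size_polyN size_digit_sum.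
- rewrite -!addrA monic_XnD // !sizeD //
    ?size_polyN ?size_polyXn ?addn1 ?size_digit_sum //.
  + by rewrite ltnS leq_addr.
  + by rewrite (leq_trans (size_digit_sum _ _ m_gt0)) // leqW // leq_addr.
- rewrite -!addrA monic_XnD // sizeD // ?size_polyN ?addn1 ?size_digit_sum //.
  exact: leq_trans (size_polyC_leq1 _) _.
Qed.

Lemma parry_polynomial_of_coef0 (t : nat -> int) (n : {poly int}) :
  (forall i, 0 <= t i) -> parry_polynomial_of t n -> n`_0 != 0.
Proof.
have coef0_Xn k : (0 < k)%N -> ('X^k : {poly int})`_0 = 0.
  by case: k => // k _; rewrite coefXn.
move=> t_ge0; case=> [m [m_gt0 /eqP tm _] | m p _ [t_per t_min] m_gt0 | p _ _].
- by rewrite coefB coef0_Xn // coef0_digit_sum // sub0r oppr_eq0.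
- rewrite coefD !coefB !coef0_digit_sum ?coef0_Xn ?addn1 //.
  rewrite sub0r subr0 addrC subr_eq0; apply/eqP => tm.
  (* If t_m = t_(m+p+1), periodicity already starts at index m, so m - 1 would be a preperiod. *)
  have [|] := t_min m.-1 p; last by rewrite leqNgt prednK ?leqnn.
  move=> i; rewrite prednK // leq_eqVlt => /orP [/eqP <- | /t_per //].
  by rewrite addnS tm.
- rewrite !coefB coef0_Xn ?addn1 // coef0_digit_sum_lt // coefC /=.
  by rewrite !sub0r oppr_eq0 gt_eqF // ltr_pwDl.
Qed.

(** A constant with unit leading coefficient is a unit of Z[X]. Excluding it guarantees that q has a
    complex root. *)
Lemma irreducible_unit_lead_size (q : {poly int}) :
  irreducible_Zpoly q -> lead_coef q \is a GRing.unit -> size q != 1.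
Proof.
move=> [_ q_nunit _] q_lead; apply: contraNneq q_nunit => sz_q.
by rewrite poly_unitE sz_q eqxx; move: q_lead; rewrite lead_coefE sz_q.
Qed.

Theorem theorem3p18 (R : realType) (beta : R) (n P : {poly int}) :
  parry_number beta ->
  parry_polynomial beta n ->
  minimal_polynomial beta P ->
  forall q : {poly int},
    irreducible_Zpoly q ->
    divides_Zpoly q n ->
    ~ associated_Zpoly q P ->
    ~ cyclotomic_Zpoly q ->
    exists2 z : complex R, root (map_poly intr q) z & 1 < `|z|.
Proof.
move=> [beta_gt1 _ _] n_parry _ q q_irr [r n_def] _ q_ncyc.
pose qC := map_poly intr q : {poly complex R}.
have q_lead : lead_coef q \is a GRing.unit.
  have := parry_polynomial_of_monic n_parry; rewrite monicE n_def lead_coefM.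
  by move/eqP => lead1; apply/unitrPr; exists (lead_coef r).
have q0_neq0 : q`_0 != 0.
  have := parry_polynomial_of_coef0 (renyi_digit_ge0 beta_gt1) n_parry.
  by rewrite n_def coef0M mulf_eq0 negb_or => /andP [].
have qC_size : size qC = size q.
  by rewrite size_map_poly_id0 // intr_eq0 lead_coef_eq0; case: q_irr.
have qC_neq0 : qC != 0.
  by rewrite -size_poly_gt0 qC_size size_poly_gt0; case: q_irr.
(* Listing the roots makes the existence of one outside the unit disk decidable. *)
have [s qC_def] := closed_field_poly_normal qC.
have root_s z : root qC z = (z \in s).
  by rewrite qC_def rootZ ?lead_coef_eq0 // root_prod_XsubC.
have [/hasP [z zs z_gt1] | /hasPn s_le1] := boolP (has (fun z => 1 < `|z|) s).
  by exists z; rewrite // -/qC root_s.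
have [z qz] : exists z, root qC z.
  by apply/closed_rootP; rewrite qC_size irreducible_unit_lead_size.
have z_neq0 : z != 0.
  apply: contraTneq qz => ->.
  by rewrite /root horner_coef0 coef_map intr_eq0.
have [|k k_gt0 zk1] := kronecker q_lead _ qz z_neq0.
  (* The order on [complex R] is partial; the negation becomes an inequality because norms are
     real. *)
  by move=> w; rewrite -/qC root_s real_leNgt ?normr_real ?real1 // => /s_le1.
by case: q_ncyc; apply: irreducible_root_unity_cyclotomic qz k_gt0 zk1.
Qed.
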